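(* Let $n,\delta\in\mathbb{N}$ with $\delta\ge3$. If $G$ is a connected $C_4$-free graph of order $n$ and minimum degree $\delta$, then \[\pi(G)\le\frac54\left\lfloor\frac{n}{\delta^2-2\lfloor\delta/2\rfloor+1}\right\rfloor+\frac{147}{32}.\]
   Context: $C_4$-free means containing no 4-cycle as a subgraph. For a connected graph $G$ of order $n\ge2$ and vertex $v$, $\overline{\sigma}(v)=\frac{1}{n-1}\sum_w d(v,w)$; the proximity is $\pi(G)=\min_v\overline{\sigma}(v)$. *)

(* Defs.v *)
From mathcomp Require Import all_boot all_order all_algebra.

Set Implicit Arguments.
Unset Strict Implicit.
Unset Printing Implicit Defensive.

Import Order.TTheory GRing.Theory Num.Theory.
Local Open Scope ring_scope.

Record sgraph := SGraph {
  vertex :> finType;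
  adj : rel vertex;
  adj_sym : symmetric adj;
  adj_irrefl : irreflexive adj
}.

Definition connected_graph (G : sgraph) : Prop :=
  forall u v : G, connect (@adj G) u v.

(* The 4-cycle need not be induced: nothing is required of the diagonals. *)
Definition C4_free (G : sgraph) : Prop :=
  forall a b c d : G, ~ ucycle (@adj G) [:: a; b; c; d].

Definition degree (G : sgraph) (v : G) : nat := #|[set w | adj v w]|.

(* Degrees are smaller than #|G|, so the default value #|G| never affects the
   minimum of a nonempty graph. *)
Definition min_degree (G : sgraph) : nat :=
  \big[minn/#|G|]_(v : G) degree v.

Definition has_path (G : sgraph) (u v : G) (k : nat) : bool :=
  [exists p : k.-tuple G,
    [&& path (@adj G) u p, last u p == v & uniq (u :: p)]].

(* A path with k edges has k.+1 distinct vertices, so only lengths k < #|G|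
   can occur; the default value #|G| is taken only when no path joins u to v. *)
Definition dist (G : sgraph) (u v : G) : nat :=
  \big[minn/#|G|]_(k < #|G| | has_path u v k) k.

(* Meaningful when 2 <= #|G|. *)
Definition avg_dist (G : sgraph) (v : G) : rat :=
  (#|G|%:R - 1)^-1 * \sum_(w : G) (dist v w)%:R.

(* [pick v : G] only supplies the starting point that arg min requires; the
   value 0 is taken only by the empty graph. *)
Definition proximity (G : sgraph) : rat :=
  if [pick v : G] is Some v0
  then avg_dist [arg min_(v < v0) avg_dist v]%O
  else 0.

(* Main.v *)
(* Grow a tree on vertices pairwise at distance at least 5, joining each new one
   to an earlier one at distance at most 5; when it is maximal, every vertex of
   [G] lies within distance 4 of the tree.  Assign each vertex to a tree node
   within distance 4, and to [a] whenever it lies in the 2-ball of [a].  By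
   [C4]-freeness each node [a] then receives a weight [c a >= K], where [K] is
   the denominator of the theorem.  Let [v] be the weighted centroid, so that all
   branches at [v] weigh at most [n / 2], and let [j] be the number of nodes.
   Writing [W] for the weights of the branches, the weighted sum of the tree
   distances from [v] is at most [(sum of W^2) / 2K + K (j - 1) / 2], and
   [sum of W^2 <= (n/2)^2 + (n/2 - K)^2].  Each tree edge costs 5, and reaching
   the vertices from their nodes costs [4 n - 2 K j], because 2-balls only cost 2
   per vertex.  Together with [K j <= n], the total distance from [v] is at most
   [2 n + 5 n^2 / 4 K]. *)
Require Import Defs.
From mathcomp Require Import all_boot all_order all_algebra zify lra.

Set Implicit Arguments.
Unset Strict Implicit.
Unset Printing Implicit Defensive.

Import Order.TTheory GRing.Theory Num.Theory.

(** * Graph distance as a metric *)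

Section Distance.

Variable G : sgraph.
Implicit Types (u v w x : G) (p : seq G).

(** [dist] only sees simple paths, but every walk shortens to one. *)
Lemma dist_le_path u p : path (@adj G) u p -> dist u (last u p) <= size p.
Proof.
move=> /shortenP[q Gq Uq sub_qp].
have /uniq_leq_size/(_ sub_qp) le_qp : uniq q by case/andP: Uq.
have lt_q : size q < #|G|.
  by have := max_card (mem (u :: q)); rewrite (card_uniqP Uq).
apply: leq_trans (le_qp); rewrite /dist -minEnat -leEnat.
apply: (@bigmin_le_cond _ _ _ _ (Ordinal lt_q)).
by apply/existsP; exists (in_tuple q); rewrite Gq eqxx Uq.
Qed.

Hypothesis Gconn : connected_graph G.

(** Connectedness provides an admissible length, and every such length is below the default [#|G|],
    so the minimum is attained. *)
Lemma dist_path u v :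
  exists p, [/\ path (@adj G) u p, last u p = v & size p = dist u v].
Proof.
have [q Gq def_v] := connectP (Gconn u v).
case: (shortenP Gq) def_v => r Gr Ur _ def_v.
have lt_r : size r < #|G|.
  by have := max_card (mem (u :: r)); rewrite (card_uniqP Ur).
have Pr : has_path u v (Ordinal lt_r).
  by apply/existsP; exists (in_tuple r); rewrite Gr -def_v eqxx Ur.
have [k /existsP[p /and3P[Gp /eqP lst_p _]] def_k] :
    exists2 k : 'I_#|G|, has_path u v k & dist u v = k.
  rewrite /dist -minEnat.
  rewrite (bigmin_eq_arg _ (Ordinal lt_r)) //; last first.
    by move=> i _; rewrite leEnat ltnW.
  by case: arg_minP => // i Pi _; exists i.
by exists p; rewrite size_tuple def_k.
Qed.

Lemma dist_triangle u v w : dist u w <= dist u v + dist v w.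
Proof.
have [p [Gp def_v <-]] := dist_path u v.
have [q [Gq def_w <-]] := dist_path v w.
rewrite -size_cat -def_w -def_v -last_cat; apply: dist_le_path.
by rewrite cat_path Gp def_v.
Qed.

Lemma dist_sym u v : dist u v = dist v u.
Proof.
suff le_d x y : dist x y <= dist y x by apply/eqP; rewrite eqn_leq !le_d.
have [p [Gp def_x <-]] := dist_path y x.
have /dist_le_path : path (@adj G) x (rev (belast y p)).
  by rewrite -def_x rev_path; under eq_path do rewrite adj_sym.
rewrite size_rev size_belast; case: p Gp def_x => [_ <- //|z p _ _].
by rewrite rev_cons last_rcons.
Qed.

Lemma dist0 u : dist u u = 0.
Proof. by apply/eqP; rewrite -leqn0; apply: (@dist_le_path u [::]). Qed.

Lemma dist_adj u v : adj u v -> dist u v <= 1.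
Proof. by move=> uv; apply: (@dist_le_path u [:: v]); rewrite /= uv. Qed.

End Distance.

(** * Sizes of 2-balls in graphs without 4-cycles *)

Lemma card_even_involution (T : finType) (f : T -> T) (A : {set T}) :
  {in A, forall x, [/\ f x \in A, f x != x & f (f x) = x]} -> ~~ odd #|A|.
Proof.
have [m] := ubnP #|A|; elim: m A => // m IHm A ltAm Af.
have [->|[x Ax]] := set_0Vmem A; first by rewrite cards0.
have [Afx nfx ffx] := Af x Ax.
have cardA : #|A| = #|A :\ x :\ f x|.+2.
  by rewrite (cardsD1 x) Ax (cardsD1 (f x)) !inE nfx Afx.
rewrite cardA /= negbK IHm //; first by rewrite cardA in ltAm; lia.
move=> y /setD1P[nyfx /setD1P[nyx Ay]].
have [Afy nfy ffy] := Af y Ay; split=> //; rewrite !inE Afy andbT.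
rewrite (can_in_eq (f := f) (g := f) (D := mem A)) //; last by move=> z /Af[].
rewrite nyx /=; apply: contraNneq nyfx => fy_x.
by rewrite -fy_x ffy.
Qed.

Section Ball.

Variable G : sgraph.
Implicit Types (u v w x : G).

Definition nbhd v : {set G} := [set w | adj v w].

Definition sphere2 v : {set G} :=
  \bigcup_(u in nbhd v) (nbhd u :\: (v |: nbhd v)).

Definition ball2 v : {set G} := v |: nbhd v :|: sphere2 v.

Lemma min_degree_le v : min_degree G <= degree v.
Proof.
rewrite /min_degree -minEnat -leEnat.
exact: (@bigmin_le_cond _ _ _ _ v).
Qed.

Hypothesis G4 : C4_free G.

Lemma codegree_le1 u v : u != v -> #|nbhd u :&: nbhd v| <= 1.
Proof.
move=> nuv; rewrite leqNgt; apply/negP => /card_gt1P[x [y]].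
rewrite !inE => -[/andP[ux vx] /andP[uy vy] nxy].
have ne (a b : G) : adj a b -> a != b.
  by apply: contraTneq => ->; rewrite adj_irrefl.
apply: (G4 (a := u) (b := x) (c := v) (d := y)); apply/andP; split.
  by rewrite /= ux (adj_sym x) vx vy (adj_sym y) uy.
rewrite /= !inE !negb_or nuv nxy (ne _ _ ux) (ne _ _ uy) (ne _ _ vy).
by rewrite (eq_sym x v) (ne _ _ vx).
Qed.

(* The edges inside [nbhd v] form a matching, hence the parity correction. *)
Lemma card_sphere2 v d : (forall u, d <= degree u) ->
  degree v * d <= degree v + 2 * (degree v %/ 2) + #|sphere2 v|.
Proof.
move=> le_d; set N := nbhd v.
have irr u : adj u u = false by exact: adj_irrefl.
(* [T] is the set of vertices covered by the matching inside [N]; exchanging partners, as [f] does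
   below, shows that it has even size. *)
pose T := [set u in N | [exists w, w \in nbhd u :&: N]].
have nv u : u \in N -> u != v.
  by rewrite inE; apply: contraTneq => ->; rewrite irr.
have evenT : ~~ odd #|T|.
  pose f u := odflt u [pick w | w \in nbhd u :&: N].
  apply: (@card_even_involution _ f) => u; rewrite inE => /andP[Nu].
  case/existsP=> w1 uw1; rewrite {1 2 4}/f.
  case: pickP => [w /= uw|/(_ w1)]; last by rewrite uw1.
  have /setIP[] := uw; rewrite inE => auw Nw.
  have wu : u \in nbhd w :&: N by rewrite in_setI Nu inE adj_sym auw.
  split; first by rewrite inE Nw; apply/existsP; exists u.
    by apply: contraTneq auw => ->; rewrite irr.
  rewrite /f; case: pickP => [x /= wx|/(_ u)]; last by rewrite wu.
  by apply: (card_le1_eqP (codegree_le1 (nv w Nw))).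
have leT : #|T| <= 2 * (degree v %/ 2).
  have : #|T| <= degree v by apply/subset_leq_card/subsetP=> u /setIdP[].
  move: evenT; lia.
(* The edges leaving [N] are counted from their other end [x]: the vertex [v] receives [degree v],
   and any other [x] at most one. *)
have le_x x : #|N :&: nbhd x|
    <= (x == v) * degree v + (x \in T) + (x \in sphere2 v).
  have [-> | nxv] := eqVneq x v; first by rewrite setIid mul1n -addnA leq_addr.
  have [-> | [u uNx]] := set_0Vmem (N :&: nbhd x); first by rewrite cards0.
  rewrite setIC; apply: leq_trans (codegree_le1 nxv) _; rewrite mul0n add0n.
  have [Nu xu] := setIP uNx.
  have [xN | xN] := boolP (x \in N).
    suff -> : x \in T by [].
    by rewrite inE xN; apply/existsP; exists u; rewrite setIC.
  suff -> : x \in sphere2 v by rewrite addn1.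
  apply/bigcupP; exists u; rewrite // in_setD in_setU1 negb_or nxv xN.
  by move: xu; rewrite !inE adj_sym.
have -> : degree v * d = \sum_(u in N) d by rewrite sum_nat_const.
apply: (@leq_trans (\sum_x #|N :&: nbhd x|)).
  apply: (@leq_trans (\sum_(u in N) \sum_(x in nbhd u) 1)).
    by apply: leq_sum => u _; rewrite sum1_card; apply: le_d.
  rewrite (exchange_big_dep predT) //=; apply: leq_sum => x _.
  rewrite sum1_card; apply/subset_leq_card/subsetP=> u.
  by rewrite [in X in X -> _]unfold_in !inE (adj_sym x).
apply: leq_trans (leq_sum _ (fun x _ => le_x x)) _.
rewrite !big_split /= -big_distrl /= -!sum1_card.
apply: leq_add; last first.
  by rewrite [X in _ <= X]big_mkcond; apply: leq_sum => x _; case: ifP.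
apply: leq_add; last first.
  apply: leq_trans leT.
  by rewrite -sum1_card [X in _ <= X]big_mkcond; apply: leq_sum => x _; case: ifP.
by rewrite (bigD1 v) //= eqxx big1 ?addn0 ?mul1n // => x /negPf->.
Qed.

Lemma card_ball2 v d : 3 <= d -> (forall u, d <= degree u) ->
  d ^ 2 - 2 * (d %/ 2) + 1 <= #|ball2 v|.
Proof.
move=> d3 le_d.
have disj : [disjoint v |: nbhd v & sphere2 v].
  apply/bigcup_disjointP => u _.
  rewrite -setI_eq0; apply/eqP/setP=> x; rewrite !inE.
  by case: (x == v); case: (adj v x).
have nv : v \notin nbhd v by rewrite inE adj_irrefl.
have -> : #|ball2 v| = degree v + 1 + #|sphere2 v|.
  rewrite /ball2 cardsU (disjoint_setI0 disj) cards0 subn0 cardsU1 nv.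
  by rewrite [1 + _]addnC.
have := card_sphere2 v le_d; have := le_d v.
move: (degree v) #|_| => D s le_D.
have [j ->] : exists j, D = d + j by exists (D - d); lia.
(* A degree excess [j] gains [j * d] and costs at most [2 * j] in the parity term, so degree [d] is
   the worst case. *)
have : 2 * ((d + j) %/ 2) <= 2 * (d %/ 2) + 2 * j by lia.
have : 2 * (d %/ 2) <= d by lia.
nia.
Qed.

End Ball.

(* First-child/next-sibling encoding: [Branch a f g] is a tree with root [a] and
   subtrees [f], followed by the trees of [g]. *)
Inductive forest (V : Type) := Empty | Branch of V & forest V & forest V.
Arguments Empty {V}.

(** * Weighted trees: depth sums, centroid, insertion of a leaf *)

Section Forest.

Variables (V : eqType) (c : V -> nat) (e : rel V).
Implicit Types (a r : V) (f g h : forest V).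

Fixpoint nodes f : seq V :=
  if f is Branch a g h then a :: nodes g ++ nodes h else [::].

Fixpoint fcat f g : forest V :=
  if f is Branch a f1 f2 then Branch a f1 (fcat f2 g) else g.

(** The parent [r] of the top nodes stays outside the forest, so a rooted tree is a pair [r],
    [f]. *)
Fixpoint linked r f : bool :=
  if f is Branch a g h then [&& e r a, linked a g & linked r h] else true.

Definition weight f := \sum_(a <- nodes f) c a.

Fixpoint light m f : bool :=
  if f is Branch a g h then (2 * (c a + weight g) <= m) && light m h else true.

(** The sum of [c] times depth, the top nodes having depth 1, collected edge by edge: each edge
    counts the weight hanging below it. *)
Fixpoint weighted_depth f : nat :=
  if f is Branch a g h
  then c a + weight g + weighted_depth g + weighted_depth h else 0.

Fixpoint sum_sq_branches f : nat :=
  if f is Branch a g h then (c a + weight g) ^ 2 + sum_sq_branches h else 0.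

Lemma nodes_fcat f g : nodes (fcat f g) = nodes f ++ nodes g.
Proof. by elim: f => //= a f1 _ f2 ->; rewrite catA. Qed.

Lemma linked_fcat r f g : linked r (fcat f g) = linked r f && linked r g.
Proof. by elim: f => //= a f1 _ f2 ->; rewrite -!andbA. Qed.

Lemma weight_Branch a f g : weight (Branch a f g) = c a + weight f + weight g.
Proof. by rewrite /weight big_cons big_cat /= addnA. Qed.

Lemma sum_sq_le_weight f : sum_sq_branches f <= weight f ^ 2.
Proof.
elim: f => //= a f _ g IHg; rewrite weight_Branch; nia.
Qed.

(** Paths with all weights equal to [k] give equality. *)
Lemma weighted_depth_le k f : {in nodes f, forall a, k <= c a} ->
  2 * k * weighted_depth f <= sum_sq_branches f + k ^ 2 * size (nodes f).
Proof.
elim: f => [|a f IHf g IHg] /= le_kc; first by rewrite !muln0.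
have {}IHf := IHf _; have {}IHg := IHg _.
have /IHf {}IHf : {in nodes f, forall a, k <= c a}.
  by move=> b fb; apply: le_kc; rewrite inE mem_cat fb orbT.
have /IHg {}IHg : {in nodes g, forall a, k <= c a}.
  by move=> b gb; apply: le_kc; rewrite inE mem_cat gb !orbT.
have := le_kc a (mem_head _ _); rewrite size_cat.
have := sum_sq_le_weight f.
move: (weight f) (sum_sq_branches f) (sum_sq_branches g) IHf IHg => w s t.
move: (weighted_depth f) (weighted_depth g) (size _) (size _) => F1 F2 n1 n2.
move=> IHf IHg le_s le_c.
(* This is [w <= c a + w - k], squared; the term [w ^ 2] pays for the branches below [a]. *)
have : 2 * k * (c a + w) + w ^ 2 <= (c a + w) ^ 2 + k ^ 2 by nia.
nia.
Qed.

(* For a given total, weights bounded by [m / 2] have the largest sum of squares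
   when one branch weighs [m / 2] and a second one carries the rest. *)
Lemma sum_sq_light m f : light m f ->
  4 * sum_sq_branches f <=
    if 2 * weight f <= m then 4 * weight f ^ 2
    else m ^ 2 + (2 * weight f - m) ^ 2.
Proof.
elim: f => [|a f _ g IHg] //=; rewrite weight_Branch.
move: (c a + weight f) (weight g) (sum_sq_branches g) IHg => w t s IHg.
move=> /andP[le_w /IHg {IHg}]; case: (leqP (2 * t) m) => le_t IHg; last first.
  case: ifP => [|_]; first lia.
  have [x def_x] : exists x, 2 * t = m + x by exists (2 * t - m); lia.
  rewrite (_ : 2 * (w + t) - m = x + 2 * w); last lia.
  rewrite (_ : 2 * t - m = x) in IHg; last lia.
  nia.
case: (leqP (2 * (w + t)) m) => [_|lt_m]; first nia.
have [x def_x] : exists x, 2 * (w + t) = m + x by exists (2 * (w + t) - m); lia.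
rewrite def_x addKn.
(* In these slacks, [m ^ 2 + x ^ 2] exceeds [4 * w ^ 2 + 4 * t ^ 2] by [2 * y * z]. *)
have [y def_y] : exists y, m = 2 * w + y by exists (m - 2 * w); lia.
have [z def_z] : exists z, m = 2 * t + z by exists (m - 2 * t); lia.
nia.
Qed.

(** The root moves into a branch heavier than half as long as there is one; symmetry of [e] allows
    the edge crossed to be reversed. *)
Lemma centroid r f : symmetric e -> linked r f ->
  let m := c r + weight f in
  exists r' f', [/\ linked r' f', perm_eq (r' :: nodes f') (r :: nodes f)
    & light m f'].
Proof.
move=> e_sym.
(* Of the branches at the current root [a], those in [g] are known to be light and those in [h] are
   still to be examined. *)
suff main h a g m : m = c a + weight g + weight h ->
    linked a g -> linked a h -> light m g ->
    exists r' f', [/\ linked r' f',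
      perm_eq (r' :: nodes f') (a :: nodes g ++ nodes h) & light m f'].
  by move=> rf m; apply: (main f r Empty); rewrite // /weight big_nil addn0.
elim: h a g => [|b h1 IH1 h2 IH2] a g def_m ag.
  by move=> _ lt_g; exists a, g; rewrite cats0.
rewrite /= => /and3P[ab bh1 ah2] lt_g; rewrite weight_Branch in def_m.
have [lt_h1|gt_h1] := leqP (2 * (c b + weight h1)) m.
  have [||||r' [f' [r'f' eq_f' lt_f']]] := IH2 a (Branch b h1 g).
  - by rewrite weight_Branch; lia.
  - by rewrite /= ab bh1.
  - by [].
  - by rewrite /= lt_h1.
  exists r', f'; split=> //; apply: (perm_trans eq_f').
  by apply/permP => p /=; rewrite !count_cat /= !count_cat; lia.
(* The branch at [b] outweighs half, so everything else, hung below [a], is one light branch at [b];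
   only [h1] remains. *)
have [||||r' [f' [r'f' eq_f' lt_f']]] := IH1 b (Branch a (fcat g h2) Empty).
- by rewrite weight_Branch /weight nodes_fcat big_cat big_nil /= -!/(weight _); lia.
- by rewrite /= linked_fcat e_sym ab ag ah2.
- by [].
- by rewrite /= /weight nodes_fcat big_cat /= -!/(weight _); lia.
exists r', f'; split=> //; apply: (perm_trans eq_f').
apply/permP => p /=; rewrite !count_cat /= !count_cat nodes_fcat count_cat /=; lia.
Qed.

Lemma insert_leaf r f a b : linked r f -> a \in r :: nodes f -> e a b ->
  exists2 f', linked r f' & perm_eq (nodes f') (b :: nodes f).
Proof.
move=> rf a_rf ab; elim: f r rf a_rf => [|d f IHf g IHg] r /=.
  by rewrite inE => _ /eqP ra; exists (Branch b Empty Empty); rewrite //= -ra ab.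
case/and3P=> rd df rg; have [def_r _|nra] := eqVneq r a.
  by exists (Branch b Empty (Branch d f g)); rewrite //= {1}def_r ab rd df.
rewrite !inE eq_sym (negPf nra) /= mem_cat orbA => /orP[a_df|a_g].
  have [||f' df' eq_f'] := IHf d; rewrite ?inE //.
  exists (Branch d f' g); first by rewrite /= rd df'.
  by apply/permP => p; move/permP/(_ p): eq_f'; rewrite /= !count_cat /=; lia.
have [||g' rg' eq_g'] := IHg r; rewrite ?inE ?a_g ?orbT //.
exists (Branch d f g'); first by rewrite /= rd df.
by apply/permP => p; move/permP/(_ p): eq_g'; rewrite /= !count_cat /=; lia.
Qed.

End Forest.

(** * Trees of spread-out centers and the resulting bound on a distance sum *)

Section Centers.

Variable G : sgraph.
Hypothesis Gconn : connected_graph G.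
Implicit Types (u v w x r a b : G) (f : forest G).

Definition near : rel G := fun u v => dist u v <= 5.

Lemma near_sym : symmetric near.
Proof. by move=> u v; rewrite /near dist_sym. Qed.

(** By the triangle inequality, each tree edge costs at most 5 per unit of weight below it. *)
Lemma sum_dist_linked (c : G -> nat) r f : linked near r f ->
  \sum_(a <- nodes f) c a * dist r a <= 5 * weighted_depth c f.
Proof.
elim: f r => [|a f IHf g IHg] r /=; first by rewrite big_nil.
case/and3P=> ra /IHf{}IHf /IHg{}IHg; rewrite big_cons big_cat /=.
have le_a : c a * dist r a <= 5 * c a by rewrite mulnC leq_mul2r; apply/orP; right.
have le_f : \sum_(b <- nodes f) c b * dist r b
    <= 5 * weight c f + \sum_(b <- nodes f) c b * dist a b.
  rewrite /weight big_distrr -big_split /=; apply: leq_sum => b _.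
  have := dist_triangle Gconn r a b; move: ra; rewrite /near; nia.
apply: leq_trans (leq_add le_a (leq_add le_f IHg)) _.
move: (weight _ _) (weighted_depth _ _) (weighted_depth _ _) (bigop _ _ _) IHf
 => w F1 F2 D.
lia.
Qed.

(** The first vertex of the path beyond distance 4 works: its predecessor is within 4 of some
    [a]. *)
Lemma boundary_vertex (s : seq G) u p : path (@adj G) u p ->
    has (fun a => dist a u <= 4) s -> ~~ has (fun a => dist a (last u p) <= 4) s ->
  exists2 b, ~~ has (fun a => dist a b <= 4) s & exists2 a, a \in s & near a b.
Proof.
elim: p u => [|w p IHp] u /=; first by move=> _ ->.
case/andP=> uw Gp su; case: (boolP (has (fun a => dist a w <= 4) s)) => [sw|].
  exact: IHp.
exists w => //; have /hasP[a sa au] := su; exists a => //.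
have := dist_triangle Gconn a u w; have := dist_adj uw; rewrite /near; lia.
Qed.

Lemma centers r0 : exists r f,
  [/\ linked near r f, uniq (r :: nodes f),
      {in r :: nodes f &, forall a b, a != b -> 5 <= dist a b}
    & forall x, has (fun a => dist a x <= 4) (r :: nodes f)].
Proof.
(* Growth stops because the centers are distinct, hence at most [#|G|] in number. *)
suff main m f : #|G| - size (nodes f) < m -> linked near r0 f ->
    uniq (r0 :: nodes f) ->
    {in r0 :: nodes f &, forall a b, a != b -> 5 <= dist a b} ->
  exists r f,
  [/\ linked near r f, uniq (r :: nodes f),
      {in r :: nodes f &, forall a b, a != b -> 5 <= dist a b}
    & forall x, has (fun a => dist a x <= 4) (r :: nodes f)].
  apply: (main _ Empty (ltnSn _)) => //= a b; rewrite !inE => /eqP-> /eqP->.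
  by rewrite eqxx.
elim: m f => // m IHm f lt_m rf Uf far_f.
have [/forallP cov|] := boolP
    [forall x, has (fun a => dist a x <= 4) (r0 :: nodes f)].
  by exists r0, f.
case/forallPn=> x far_x; have [p [Gp def_x _]] := dist_path Gconn r0 x.
have [||b far_b [a sa ab]] := boundary_vertex (s := r0 :: nodes f) Gp.
- by rewrite /= dist0.
- by rewrite def_x.
have [f' rf' eq_f'] := insert_leaf rf sa ab.
have eq_s : perm_eq (r0 :: nodes f') (b :: r0 :: nodes f).
  by apply/permP => q; move/permP/(_ q): eq_f' => /=; lia.
have {}far_b c : c \in r0 :: nodes f -> 5 <= dist c b.
  by move=> sc; have /hasPn/(_ c sc) := far_b; rewrite -ltnNge.
have nb : b \notin r0 :: nodes f by apply/negP => /far_b; rewrite dist0.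
apply: (IHm f') => //.
- have lt_s : size (nodes f) < #|G|.
    by have := max_card (mem (r0 :: nodes f)); rewrite (card_uniqP Uf).
  by rewrite (perm_size eq_f') /= subnSK.
- by rewrite (perm_uniq eq_s) cons_uniq nb.
- move=> c d; rewrite !(perm_mem eq_s) ![_ \in b :: _]inE.
  case/predU1P=> [->|sc] /predU1P[->|sd]; rewrite ?eqxx // => ncd.
  + by rewrite dist_sym // far_b.
  + exact: far_b.
  + exact: far_f.
Qed.

Lemma dist_ball2 a x : x \in ball2 a -> dist a x <= 2.
Proof.
rewrite !inE -orbA => /or3P[/eqP-> | /dist_adj/leqW // |]; first by rewrite dist0.
case/bigcupP=> u; rewrite inE => /dist_adj au; rewrite !inE => /andP[_ /dist_adj ux].
have := dist_triangle Gconn a u x; lia.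
Qed.

Lemma sum_dist_le k r0 : (forall v, k <= #|ball2 v|) ->
  exists v, 4 * k * \sum_w dist v w <= 8 * k * #|G| + 5 * #|G| ^ 2.
Proof.
move=> le_k; have [r [f [rf Us far_s cov]]] := centers r0.
set s := r :: nodes f in Us far_s cov.
(* [m x] is the center serving [x]. It is forced when [x] lies in the 2-ball of a center, since two
   such centers would be within distance 4. *)
have /fin_all_exists[m m_spec] x : exists a,
    [/\ a \in s, dist a x <= 4 & {in s, forall b, x \in ball2 b -> b = a}].
  have [/hasP[a sa xa]|/hasPn far_x] := boolP (has (fun a => x \in ball2 a) s).
    exists a; split=> //; first by apply: leq_trans (dist_ball2 xa) _.
    move=> b sb xb; apply/eqP/negPn/negP => /(far_s _ _ sb sa).
    have := dist_triangle Gconn b x a; rewrite [dist x a]dist_sym //.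
    have := dist_ball2 xa; have := dist_ball2 xb; lia.
  have /hasP[a sa ax] := cov x; exists a; split=> // b /far_x.
  by move/negPf->.
pose c a := \sum_(x | m x == a) 1.
have sum_s (F : G -> G -> nat) : \sum_x F (m x) x
    = \sum_(a <- s) \sum_(x | m x == a) F a x.
  rewrite (partition_big m (mem s)) /= => [|x _]; last by case: (m_spec x).
  rewrite big_uniq //=; apply: eq_bigr => a _.
  by apply: eq_bigr => x /eqP->.
have le_ball a : a \in s ->
    #|ball2 a| <= \sum_(x | m x == a) (x \in ball2 a).
  move=> sa; rewrite -sum1_card big_mkcond [X in _ <= X]big_mkcond /=.
  apply: leq_sum => x _; case: ifP => // xa.
  by have [_ _ /(_ a sa xa) <-] := m_spec x; rewrite eqxx.
have le_c a : a \in s -> k <= c a.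
  move=> sa; apply: leq_trans (le_k a) (leq_trans (le_ball a sa) _).
  by apply: leq_sum => x _; case: (x \in _).
(* At least [k] of the vertices served by [a] lie in its 2-ball, and each of these saves 2 on the
   cost 4. *)
have le_out a : a \in s ->
    \sum_(x | m x == a) dist a x + 2 * k <= 4 * c a.
  move=> sa; have /(leq_mul (leqnn 2)) := leq_trans (le_k a) (le_ball a sa).
  move/(leq_add (leqnn (\sum_(x | m x == a) dist a x)))/leq_trans; apply.
  rewrite !big_distrr -big_split /=; apply: leq_sum => x /eqP <-.
  have [_ le4 _] := m_spec x; case: (boolP (_ \in _)) => [/dist_ball2|_]; lia.
have card_s : \sum_(a <- s) c a = #|G| by rewrite -(sum_s (fun _ _ => 1)) sum1_card.
have [v [f' [vf' eq_s light_f']]] := centroid c near_sym rf.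
rewrite [_ + weight _ _](_ : _ = #|G|) in light_f'; last first.
  by rewrite -card_s big_cons.
exists v.
have {}le_out : \sum_w dist v w + 2 * k * size s
    <= 4 * #|G| + \sum_(a <- s) c a * dist v a.
  have le_tri : \sum_w dist v w <= \sum_w (dist v (m w) + dist (m w) w).
    by apply: leq_sum => w _; apply: dist_triangle.
  apply: leq_trans (leq_add le_tri (leqnn _)) _.
  rewrite (sum_s (fun a w => dist v a + dist a w)) -card_s big_distrr /=.
  have -> : 2 * k * size s = \sum_(a <- s) 2 * k.
    by rewrite big_const_seq count_predT iter_addn_0.
  rewrite -!big_split /= big_seq [X in _ <= X]big_seq; apply: leq_sum => a sa.
  have -> : c a * dist v a = \sum_(x | m x == a) dist v a.
    by rewrite /c big_distrl /=; apply: eq_bigr => x _; rewrite mul1n.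
  rewrite big_split /=; have := le_out a sa; lia.
have size_s : k * size s <= #|G|.
  have -> : k * size s = \sum_(a <- s) k.
    by rewrite big_const_seq count_predT iter_addn_0.
  rewrite -card_s big_seq [X in _ <= X]big_seq; exact: leq_sum.
have sum_v F : \sum_(a <- s) F a = F v + \sum_(a <- nodes f') F a.
  by rewrite -(perm_big _ eq_s) big_cons.
rewrite sum_v dist0 muln0 add0n in le_out.
have := sum_dist_linked c vf'.
have := sum_sq_light light_f'.
have /weighted_depth_le : {in nodes f', forall a, k <= c a}.
  by move=> a f'a; apply: le_c; rewrite -(perm_mem eq_s) inE f'a orbT.
have : k <= c v by apply: le_c; rewrite -(perm_mem eq_s) mem_head.
have : c v + weight c f' = #|G|.
  by rewrite -card_s sum_v.
rewrite -(perm_size eq_s) /= in le_out size_s.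
move: (c v) (weight _ _) (weighted_depth _ _) (sum_sq_branches _ _) (size _) #|G|
  le_out size_s light_f' => cv T F Q j N.
move: (\sum_(a <- _) _) (\sum_w _) => D S le_S le_N _ def_N le_cv le_F le_Q le_D.
(* This is [Q <= (N / 2) ^ 2 + (N / 2 - k) ^ 2] without denominators: the root keeps weight at least
   [k], leaving at most [N - k] to the branches. *)
have {}le_Q : 2 * Q + 2 * N * k <= N ^ 2 + 2 * k ^ 2.
  have le_Tk : T + k <= N by lia.
  case: ifP le_Q => [|/negbT]; rewrite -?ltnNge => le_T le_Q.
    have [i def_i] : exists i, N = T + k + i by exists (N - (T + k)); lia.
    have {le_Q} : 2 * Q <= 2 * T ^ 2 by lia.
    case: (leqP T k) => [ltTk|ltkT]; first by rewrite def_i; nia.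
    have [h def_h] : exists h, N = 2 * T + h by exists (N - 2 * T); lia.
    have [l def_l] : exists l, T = k + l by exists (T - k); lia.
    rewrite def_h def_l; nia.
  have [h def_h] : exists h, 2 * T = N + h by exists (2 * T - N); lia.
  have [l def_l] : exists l, N = 2 * k + h + l by exists (N - (2 * k + h)); lia.
  rewrite def_h addKn in le_Q.
  have : h ^ 2 <= (h + l) ^ 2 by rewrite leq_exp2r // leq_addr.
  rewrite def_l in le_Q *; nia.
(* The bounds combine to [4 * k * S <= 6 * k * N + 5 * N ^ 2 + 2 * k ^ 2 * j.+1], and
   [k * j.+1 <= N] absorbs the last term. *)
nia.
Qed.

End Centers.

(** * From the distance sum to the proximity *)

Local Open Scope ring_scope.

Lemma proximity_le (G : sgraph) (v : G) : proximity G <= avg_dist v.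
Proof.
rewrite /proximity; case: pickP => [v0 _|/(_ v)] //.
by case: arg_minP => // u _ /(_ v); apply.
Qed.

Theorem theorem6p4 (n delta : nat) (G : sgraph) :
  (3 <= delta)%N ->
  connected_graph G ->
  C4_free G ->
  #|G| = n ->
  min_degree G = delta ->
  proximity G <=
    5 / 4 * (n %/ (delta ^ 2 - 2 * (delta %/ 2) + 1))%:R + 147 / 32.
Proof.
move=> d3 Gconn G4 card_G min_d.
case: (pickP (@predT G)) => [r0 _|G0]; last first.
  (* On the empty graph [min_degree] takes its default value 0, against [3 <= delta]. *)
  by exfalso; move: d3; rewrite -min_d /min_degree big_pred0 ?(eq_card0 G0).
set k := (delta ^ 2 - 2 * (delta %/ 2) + 1)%N.
have le_k (v : G) : (k <= #|ball2 v|)%N.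
  by apply: (card_ball2 G4 v d3) => u; rewrite -min_d min_degree_le.
have [v le_S] := sum_dist_le Gconn r0 le_k.
apply: le_trans (proximity_le v) _.
have k7 : (7 <= k)%N.
  have : (2 * (delta %/ 2) <= delta)%N by lia.
  have : (3 * delta <= delta ^ 2)%N by rewrite leq_mul2r d3 orbT.
  rewrite /k; lia.
have le_kn : (k <= n)%N by rewrite -card_G; apply: leq_trans (le_k v) (max_card _).
have lt_n := ltn_ceil n (leq_trans (isT : (0 < 7)%N) k7).
have le_n := leq_divM n k.
rewrite card_G in le_S; rewrite /avg_dist card_G -natr_sum.
move: (\sum_(w : G) dist v w)%N (n %/ k)%N => S q in le_S lt_n le_n *.
(* The goal times [32 * (n - 1)], with the subtracted part moved to the left to stay in [nat]. *)
have {}le_S : (32 * S + 40 * q + 147 <= n * (40 * q + 147))%N.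
  have le4S : (4 * S <= 13 * n + 5 * n * q)%N.
    (* One factor of [n ^ 2] is replaced by its upper bound [k * q.+1], so that [k] cancels. *)
    have kS : (4 * k * S <= k * (8 * n) + 5 * (n * (k * q.+1)))%N.
      apply: leq_trans le_S _; rewrite mulnCA mulnA leq_add2l leq_mul2l orbC.
      by rewrite leq_mul2l (ltnW (leq_trans lt_n _)) ?orbT // mulnC.
    have : (k * (4 * S) <= k * (13 * n + 5 * n * q))%N.
      by move: kS; set S4 := (k * (4 * S))%N; lia.
    by rewrite leq_pmul2l //; lia.
  (* What remains is [40 * q + 147 <= 43 * n], a consequence of [7 * q <= n] and [7 <= n]. *)
  have : (7 * q <= n)%N by apply: leq_trans le_n; rewrite mulnC leq_mul2l k7 orbT.
  lia.
have n_gt1 : 0 < n%:R - 1 :> rat by rewrite subr_gt0 ltr1n; lia.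
rewrite mulrC (ler_pdivrMr _ _ n_gt1).
have : (32 * S + 40 * q + 147)%:R <= (n * (40 * q + 147))%:R :> rat.
  by rewrite ler_nat.
lra.
Qed.
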